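(* Let $\mathfrak{g}=\mathfrak{sl}_2(\mathbb{C})$. For every integer $n\ge1$, \[S^{\mathfrak{g}}_{2n}(\mathfrak{g},\mathfrak{g})=0\quad\text{and}\quad S^{\mathfrak{g}}_{2n+1}(\mathfrak{g},\mathfrak{g})=\mathbb{C}\,B^{\mathfrak{g}}_n.\]
   Context: $S^{\mathfrak{g}}_m(\mathfrak{g},\mathfrak{g})$ denotes the space of symmetric $\mathbb{C}$-multilinear maps $B:\mathfrak{g}^m\to\mathfrak{g}$ that are invariant: $[y,B(x_1,\ldots,x_m)]=\sum_{i=1}^mB(x_1,\ldots,[y,x_i],\ldots,x_m)$ for all $y,x_1,\ldots,x_m\in\mathfrak{g}$. Let $\langle\cdot,\cdot\rangle$ be the symmetric bilinear form on $\mathfrak{g}$ with $\langle x,x\rangle=\frac12\mathrm{tr}(\mathrm{ad}_x^2)$. For $n\ge1$ let $P_n(x_1,\ldots,x_{2n})=\frac{1}{(2n)!}\sum_{\sigma\in S_{2n}}\langle x_{\sigma(1)},x_{\sigma(2)}\rangle\cdots\langle x_{\sigma(2n-1)},x_{\sigma(2n)}\rangle$, and $B^{\mathfrak{g}}_n(x_1,\ldots,x_{2n+1})=\sum_{k=1}^{2n+1}P_n(x_1,\ldots,\hat{x}_k,\ldots,x_{2n+1})\,x_k$ (hat denotes omission). *)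

(* Defs.v *)
From mathcomp Require Import all_boot all_order all_algebra all_fingroup.
From mathcomp Require Import complex Rstruct zify.
Set Implicit Arguments. Unset Strict Implicit. Unset Printing Implicit Defensive.
Import Order.TTheory GRing.Theory Num.Theory.
Local Open Scope ring_scope.

Definition C : numClosedFieldType := complex Rdefinitions.R.

Definition in_sl2 (x : 'M[C]_2) : Prop := \tr x = 0.

Definition bracket (x y : 'M[C]_2) : 'M[C]_2 := x *m y - y *m x.

Definition ad (x : 'M[C]_2) : 'M[C]_2 -> 'M[C]_2 := bracket x.

(* Standard basis e, h, f of sl_2 and the associated coordinate functionals:
   y = (y 0 1) e + (y 0 0) h + (y 1 0) f for traceless y. *)
Definition sl2_e : 'M[C]_2 := delta_mx 0 1.
Definition sl2_h : 'M[C]_2 := delta_mx 0 0 - delta_mx 1 1.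
Definition sl2_f : 'M[C]_2 := delta_mx 1 0.
Definition coord_e (y : 'M[C]_2) : C := y 0 1.
Definition coord_h (y : 'M[C]_2) : C := y 0 0.
Definition coord_f (y : 'M[C]_2) : C := y 1 0.

Definition tr_sl2 (T : 'M[C]_2 -> 'M[C]_2) : C :=
  coord_e (T sl2_e) + coord_h (T sl2_h) + coord_f (T sl2_f).

(* The symmetric bilinear form with <x,x> = 1/2 tr(ad_x^2),
   i.e. (by polarization) <x,y> = 1/2 tr(ad_x ad_y). *)
Definition kform (x y : 'M[C]_2) : C := 2^-1 * tr_sl2 (ad x \o ad y).

Definition tuple_in_sl2 (m : nat) (xs : 'I_m -> 'M[C]_2) : Prop :=
  forall i, in_sl2 (xs i).

Definition upd (m : nat) (xs : 'I_m -> 'M[C]_2) (i : 'I_m) (y : 'M[C]_2) :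
  'I_m -> 'M[C]_2 := fun j => if j == i then y else xs j.

(* B : g^m -> g is a symmetric, C-multilinear, invariant map
   (only its values on g^m matter). This is membership in S^g_m(g,g). *)
Definition in_Sg (m : nat) (B : ('I_m -> 'M[C]_2) -> 'M[C]_2) : Prop :=
  [/\ (forall xs, tuple_in_sl2 xs -> in_sl2 (B xs)),
      (forall xs i (a : C) y z, tuple_in_sl2 xs -> in_sl2 y -> in_sl2 z ->
         B (upd xs i (a *: y + z)) = a *: B (upd xs i y) + B (upd xs i z)),
      (forall xs (s : 'S_m), tuple_in_sl2 xs -> B (xs \o s) = B xs)
    & (forall y xs, in_sl2 y -> tuple_in_sl2 xs ->
         bracket y (B xs) = \sum_(i < m) B (upd xs i (bracket y (xs i))))].

Lemma ev_lt (n : nat) (k : 'I_n) : (2 * k < 2 * n)%N.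
Proof. have := ltn_ord k; lia. Qed.
Lemma od_lt (n : nat) (k : 'I_n) : (2 * k + 1 < 2 * n)%N.
Proof. have := ltn_ord k; lia. Qed.

(* The positions 2k+1 and 2k+2 (1-based), i.e. 2k and 2k+1 (0-based). *)
Definition ev_idx (n : nat) (k : 'I_n) : 'I_(2 * n) := Ordinal (ev_lt k).
Definition od_idx (n : nat) (k : 'I_n) : 'I_(2 * n) := Ordinal (od_lt k).

Definition Pn (n : nat) (xs : 'I_(2 * n) -> 'M[C]_2) : C :=
  ((2 * n)`!%:R)^-1 *
  \sum_(s : 'S_(2 * n))
     \prod_(k < n) kform (xs (s (ev_idx k))) (xs (s (od_idx k))).

Definition Bn (n : nat) (xs : 'I_(2 * n).+1 -> 'M[C]_2) : 'M[C]_2 :=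
  \sum_(k < (2 * n).+1) Pn (fun j => xs (lift k j)) *: xs k.

(* Main.v *)
Require Import Defs.
From mathcomp Require Import all_boot all_order all_algebra all_fingroup.
From mathcomp Require Import ring zify.
From Stdlib Require Import FunctionalExtensionality.
Import GRing.Theory Num.Theory.
Local Open Scope ring_scope.
Set Implicit Arguments. Unset Strict Implicit.

(* Write [v a b c] for the value of [B] on [a] copies of [e], [b] of [h] and [c]
   of [f]. Invariance under [e] and [f] reads
     [e, v a b c] = - 2 b v (a+1) (b-1) c + c v a (b+1) (c-1),
     [f, v a b c] = - a v (a-1) (b+1) c + 2 b v a (b-1) (c+1),
   so all [v a b c], hence [B], are determined by [v 0 m 0 = B(h, ..., h)], which
   commutes with [h] and is therefore a multiple of [h]. In odd degree [B_n] takes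
   a nonzero value there, and it is invariant as the symmetrization of
   [<x_0,x_1> ... <x_(2n-2),x_(2n-1)> x_2n]. In degree [2n] the recursions
   propagate [v 0 2n 0 = l h] to [v k (2n-2k) k = mu_k h] and
   [v (k-1) (2n-2k+1) k = 2 mu_k f] with [mu_k] a nonzero multiple of [l], and the
   [f]-relation at [k = n] yields [2 mu_n = - 2 n mu_n], that is [l = 0]. *)

(* Scalar equations coming from matrix entries are typed at an unfolded form of
   [C], on which [ring] fails to find its structure. *)
Ltac ring_C := match goal with |- @eq _ ?a ?b => change (@eq C a b); ring end.

(** * Entrywise computations in [sl_2]: brackets, basis and form *)

Lemma mulmx2E (x y : 'M[C]_2) i j :
  (x *m y) i j = x i 0 * y 0 j + x i 1 * y 1 j.
Proof.
rewrite mxE big_ord_recl big_ord1; congr (_ + _ * _).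
  by congr (fun_of_matrix _ _ _); apply: val_inj.
by congr (fun_of_matrix _ _ _); apply: val_inj.
Qed.

Lemma mx2P (x y : 'M[C]_2) :
  x 0 0 = y 0 0 -> x 0 1 = y 0 1 -> x 1 0 = y 1 0 -> x 1 1 = y 1 1 -> x = y.
Proof.
have ord2 (i : 'I_2) : i = 0 \/ i = 1.
  by case: i => [[|[|//]]] lt; [left | right]; apply: val_inj.
move=> h00 h01 h10 h11; apply/matrixP=> i j.
by case: (ord2 i) => ->; case: (ord2 j) => ->.
Qed.

Lemma mxtrace2 (x : 'M[C]_2) : \tr x = x 0 0 + x 1 1.
Proof.
rewrite /mxtrace big_ord_recl big_ord1; congr (_ + fun_of_matrix _ _ _); exact: val_inj.
Qed.

Lemma bracketE (x y : 'M[C]_2) i j :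
  bracket x y i j =
  x i 0 * y 0 j + x i 1 * y 1 j - (y i 0 * x 0 j + y i 1 * x 1 j).
Proof. by rewrite /bracket mxE [X in _ + X]mxE !mulmx2E. Qed.

Lemma bracket_linear (x : 'M[C]_2) a y z :
  bracket x (a *: y + z) = a *: bracket x y + bracket x z.
Proof.
by rewrite /bracket mulmxDr mulmxDl -scalemxAr -scalemxAl scalerBr opprD addrACA.
Qed.

Lemma bracketZ (x : 'M[C]_2) a y : bracket x (a *: y) = a *: bracket x y.
Proof. by rewrite /bracket -scalemxAr -scalemxAl scalerBr. Qed.

Lemma bracketD (x y z : 'M[C]_2) :
  bracket x (y + z) = bracket x y + bracket x z.
Proof. by rewrite -[y]scale1r bracket_linear bracketZ !scale1r. Qed.

Lemma bracket0 (x : 'M[C]_2) : bracket x 0 = 0.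
Proof. by rewrite /bracket mulmx0 mul0mx subr0. Qed.

Lemma bracket_sum (x : 'M[C]_2) (I : finType) (F : I -> 'M[C]_2) :
  bracket x (\sum_i F i) = \sum_i bracket x (F i).
Proof. exact: (big_morph _ (bracketD x) (bracket0 x)). Qed.

Lemma bracket_sl2 (x y : 'M[C]_2) : in_sl2 (bracket x y).
Proof. by rewrite /in_sl2 mxtrace2 !bracketE; ring_C. Qed.

Lemma bracket_ee : bracket sl2_e sl2_e = 0.
Proof. by apply: mx2P; rewrite !bracketE !mxE /=; ring_C. Qed.
Lemma bracket_eh : bracket sl2_e sl2_h = (- 2) *: sl2_e.
Proof. by apply: mx2P; rewrite !bracketE !mxE /=; ring_C. Qed.
Lemma bracket_ef : bracket sl2_e sl2_f = sl2_h.
Proof. by apply: mx2P; rewrite !bracketE !mxE /=; ring_C. Qed.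
Lemma bracket_fe : bracket sl2_f sl2_e = (- 1) *: sl2_h.
Proof. by apply: mx2P; rewrite !bracketE !mxE /=; ring_C. Qed.
Lemma bracket_fh : bracket sl2_f sl2_h = 2 *: sl2_f.
Proof. by apply: mx2P; rewrite !bracketE !mxE /=; ring_C. Qed.
Lemma bracket_ff : bracket sl2_f sl2_f = 0.
Proof. by apply: mx2P; rewrite !bracketE !mxE /=; ring_C. Qed.
Lemma bracket_hh : bracket sl2_h sl2_h = 0.
Proof. by apply: mx2P; rewrite !bracketE !mxE /=; ring_C. Qed.

Lemma sl2_decomp (x : 'M[C]_2) : in_sl2 x ->
  x = x 0 1 *: sl2_e + (x 0 0 *: sl2_h + x 1 0 *: sl2_f).
Proof.
rewrite /in_sl2 mxtrace2 => /eqP; rewrite addr_eq0 => /eqP tx.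
by apply: mx2P; rewrite !mxE /= ?tx; ring_C.
Qed.

(** [ad h] has eigenvalues 2 on [e] and -2 on [f], so both of these coordinates must vanish. *)
Lemma centralizer_h (x : 'M[C]_2) : in_sl2 x -> bracket sl2_h x = 0 ->
  x = x 0 0 *: sl2_h.
Proof.
move=> /sl2_decomp dx hx.
have two : 2 != 0 :> C by rewrite pnatr_eq0.
have h01 : x 0 1 = 0.
  apply: (mulfI two); transitivity (bracket sl2_h x 0 1).
    by rewrite bracketE !mxE /=; ring_C.
  by rewrite hx mxE mulr0.
have h10 : x 1 0 = 0.
  apply: (mulfI two); transitivity (- bracket sl2_h x 1 0).
    by rewrite bracketE !mxE /=; ring_C.
  by rewrite hx mxE mulr0 oppr0.
by rewrite {1}dx h01 h10 !scale0r add0r addr0.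
Qed.

Lemma sl2E :
  (((sl2_e 0 0 = 0) * (sl2_e 0 1 = 1) * (sl2_e 1 0 = 0) * (sl2_e 1 1 = 0)) *
   ((sl2_h 0 0 = 1) * (sl2_h 0 1 = 0) * (sl2_h 1 0 = 0) * (sl2_h 1 1 = - 1)) *
   ((sl2_f 0 0 = 0) * (sl2_f 0 1 = 0) * (sl2_f 1 0 = 1) * (sl2_f 1 1 = 0)))%type.
Proof. by do !split; rewrite !mxE /=; ring_C. Qed.

(* [bracket] is generalized before rewriting with [bracketE]: matching the
   pattern otherwise unfolds matrix operations and does not terminate in
   reasonable time. *)
Lemma kformE (x y : 'M[C]_2) :
  kform x y = (x 0 0 - x 1 1) * (y 0 0 - y 1 1) + 2 * (x 0 1 * y 1 0 + x 1 0 * y 0 1).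
Proof.
(* Clearing the factor 1/2 leaves a polynomial identity in the entries. On traceless matrices the
   right-hand side is [2 tr(xy)]. *)
apply: (@mulfI _ 2); first by rewrite pnatr_eq0.
rewrite /kform mulVKf ?pnatr_eq0 // /tr_sl2 /coord_e /coord_h /coord_f /ad /=.
move: bracketE sl2E; move: bracket sl2_e sl2_h sl2_f => br u v w brE uvwE.
by rewrite !brE !uvwE; ring_C.
Qed.

Lemma kform_linearl (a : C) x y z :
  kform (a *: x + y) z = a * kform x z + kform y z.
Proof. by rewrite !kformE !mxE; ring_C. Qed.

Lemma kform_linearr (a : C) x y z :
  kform z (a *: x + y) = a * kform z x + kform z y.
Proof. by rewrite !kformE !mxE; ring_C. Qed.

Lemma kform_invariant (x y z : 'M[C]_2) :
  kform (bracket z x) y + kform x (bracket z y) = 0.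
Proof.
rewrite !kformE; move: bracketE; move: bracket => br brE.
by rewrite !brE; ring_C.
Qed.

(** * Symmetric invariant maps evaluated on lists *)

(** With lists as arguments, symmetry becomes compatibility with [perm_eq]. The default 0 is never
    read on lists of size [m]. *)
Definition on_seq (m : nat) (B : ('I_m -> 'M[C]_2) -> 'M[C]_2)
  (s : seq 'M[C]_2) : 'M[C]_2 := B (fun i => nth 0 s i).

Definition is_sl2 (x : 'M[C]_2) : bool := \tr x == 0.

Lemma tuple_in_sl2_nth (m : nat) (s : seq 'M[C]_2) : all is_sl2 s ->
  size s = m -> @tuple_in_sl2 m (fun i => nth 0 s i).
Proof.
by move=> /allP sl2_s sz i; apply/eqP/sl2_s/mem_nth; rewrite sz.
Qed.

Lemma on_seq_perm (m : nat) (B : ('I_m -> 'M[C]_2) -> 'M[C]_2) s t :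
  in_Sg B -> all is_sl2 t -> size t = m -> perm_eq s t -> on_seq B s = on_seq B t.
Proof.
move=> [_ _ symB _] sl2_t sz eq_st.
have szs : size s == m by rewrite (perm_size eq_st) sz.
have szt : size t == m by rewrite sz.
have /tuple_permP [p sp] : perm_eq (Tuple szs) (Tuple szt) by [].
rewrite /on_seq -[RHS](symB _ p (tuple_in_sl2_nth sl2_t sz)); congr (B _).
apply: functional_extensionality => i /=.
have -> : s = [tuple tnth (Tuple szt) (p i) | i < m] by [].
by rewrite -tnth_nth tnth_mktuple (tnth_nth 0).
Qed.

(** Linearity in the head suffices, since symmetry brings any entry to the front. *)
Lemma on_seq_linear (m : nat) (B : ('I_m -> 'M[C]_2) -> 'M[C]_2) (a : C) x y s :
  in_Sg B -> in_sl2 x -> in_sl2 y -> all is_sl2 s -> (size s).+1 = m ->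
  on_seq B (a *: x + y :: s) = a *: on_seq B (x :: s) + on_seq B (y :: s).
Proof.
move=> [_ linB _ _] sl2_x sl2_y sl2_s sz.
have m_gt0 : (0 < m)%N by rewrite -sz.
have upd0 z : on_seq B (z :: s)
    = B (upd (fun j : 'I_m => nth 0 (x :: s) j) (Ordinal m_gt0) z).
  by congr (B _); apply: functional_extensionality => -[[|i] lti].
rewrite !upd0; apply: linB => //; apply: tuple_in_sl2_nth => //=.
by rewrite sl2_s andbT; apply/eqP.
Qed.

Lemma on_seqZ (m : nat) (B : ('I_m -> 'M[C]_2) -> 'M[C]_2) (a : C) x s :
  in_Sg B -> in_sl2 x -> all is_sl2 s -> (size s).+1 = m ->
  on_seq B (a *: x :: s) = a *: on_seq B (x :: s).
Proof.
move=> SB sl2_x sl2_s sz.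
have sl2_0 : in_sl2 0 by rewrite /in_sl2 mxtrace0.
have on0 : on_seq B (0 :: s) = 0.
  have /eqP := on_seq_linear 1 SB sl2_0 sl2_0 sl2_s sz.
  by rewrite !scale1r addr0 -subr_eq0 opprD addNKr oppr_eq0 => /eqP.
by rewrite -[a *: x]addr0 on_seq_linear // on0 addr0.
Qed.

(** By symmetry the modified entry may be moved to the head. [rem] may delete an earlier copy of [x]
    than the one modified, but the resulting lists agree up to permutation. *)
Lemma on_seq_invariant (m : nat) (B : ('I_m -> 'M[C]_2) -> 'M[C]_2) y s :
  in_Sg B -> in_sl2 y -> all is_sl2 s -> size s = m ->
  bracket y (on_seq B s) = \sum_(x <- s) on_seq B (bracket y x :: rem x s).
Proof.
move=> SB sl2_y sl2_s sz; have [_ _ _ invB] := SB.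
rewrite [LHS]invB //; last exact: tuple_in_sl2_nth.
rewrite (big_nth 0) sz big_mkord; apply: eq_bigr => i _.
set z := bracket y _.
have lti : (i < size s)%N by rewrite sz.
transitivity (on_seq B (set_nth 0 s i z)).
  congr (B _); apply: functional_extensionality => j.
  by rewrite /upd nth_set_nth /=.
have sl2_rem : all is_sl2 (rem (nth 0 s i) s).
  by apply/allP => x /mem_rem; apply: (allP sl2_s).
have size_rem_s : (size (rem (nth 0 s i) s)).+1 = m.
  by rewrite size_rem ?mem_nth // prednK // (leq_ltn_trans _ lti).
apply: (on_seq_perm SB _ (t := z :: rem _ s) size_rem_s).
  by apply/andP; split=> //; apply/eqP/bracket_sl2.
(* Without the new head, both sides are [s] minus its [i]-th entry; consing this entry back turns
   both into [s]. *)
rewrite set_nthE lti -cat1s perm_catCA perm_cons -(perm_cons (nth 0 s i)).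
rewrite -(permPr (perm_to_rem (mem_nth 0 lti))).
by rewrite -cat1s perm_catCA cat1s -(drop_nth 0 lti) cat_take_drop.
Qed.

(** * Recursions for [v a b c], encoded as [on_seq B (ehf a b c)] *)

Definition ehf (a b c : nat) : seq 'M[C]_2 :=
  nseq a sl2_e ++ nseq b sl2_h ++ nseq c sl2_f.

Lemma sl2_e_in : in_sl2 sl2_e.
Proof. by rewrite /in_sl2 mxtrace2 !sl2E addr0. Qed.
Lemma sl2_h_in : in_sl2 sl2_h.
Proof. by rewrite /in_sl2 mxtrace2 !sl2E subrr. Qed.
Lemma sl2_f_in : in_sl2 sl2_f.
Proof. by rewrite /in_sl2 mxtrace2 !sl2E addr0. Qed.
#[local] Hint Resolve sl2_e_in sl2_h_in sl2_f_in : core.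

Lemma all_is_sl2_ehf a b c : all is_sl2 (ehf a b c).
Proof.
have sl2P x : in_sl2 x -> is_sl2 x by move/eqP.
by rewrite !all_cat !all_nseq !sl2P // !orbT.
Qed.

Lemma size_ehf a b c : size (ehf a b c) = (a + b + c)%N.
Proof. by rewrite !size_cat !size_nseq addnA. Qed.

Lemma ehf_consh a b c : perm_eq (ehf a b.+1 c) (sl2_h :: ehf a b c).
Proof. by rewrite /ehf -[nseq b.+1 _]/([:: _] ++ _) -catA perm_catCA. Qed.

Lemma ehf_consf a b c : perm_eq (ehf a b c.+1) (sl2_f :: ehf a b c).
Proof.
rewrite /ehf -[nseq c.+1 _]/([:: _] ++ _) !catA -[X in perm_eq X _]catA.
by rewrite perm_catCA catA.
Qed.

(** On each of the three constant blocks all terms of the invariance sum coincide. For an empty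
    block the list built with [0.-1 = 0] has the wrong length, but its coefficient is 0. *)
Lemma bracket_on_ehf (m : nat) (B : ('I_m -> 'M[C]_2) -> 'M[C]_2) y a b c :
  in_Sg B -> in_sl2 y -> (a + b + c)%N = m ->
  bracket y (on_seq B (ehf a b c)) =
    a%:R *: on_seq B (bracket y sl2_e :: ehf a.-1 b c)
    + b%:R *: on_seq B (bracket y sl2_h :: ehf a b.-1 c)
    + c%:R *: on_seq B (bracket y sl2_f :: ehf a b c.-1).
Proof.
move=> SB sl2_y abc; rewrite on_seq_invariant ?all_is_sl2_ehf ?size_ehf //.
have term x t : perm_eq (ehf a b c) (x :: t) -> all is_sl2 t ->
    on_seq B (bracket y x :: rem x (ehf a b c)) = on_seq B (bracket y x :: t).
  move=> abc_t sl2_t.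
  have sz : (size t).+1 = m by move: (perm_size abc_t); rewrite size_ehf abc.
  apply: (on_seq_perm SB _ (t := bracket y x :: t) sz).
    by apply/andP; split=> //; apply/eqP/bracket_sl2.
  rewrite perm_cons -(perm_cons x) -(permPr abc_t) perm_sym perm_to_rem //.
  by rewrite (perm_mem abc_t) mem_head.
rewrite {1}/ehf !big_cat !big_nseq !iter_addr_0 !scaler_nat -[RHS]addrA.
congr (_ + (_ + _)).
- case: a abc term => // a abc term.
  by rewrite (term _ (ehf a b c)) ?all_is_sl2_ehf.
- case: b abc term => // b abc term.
  by rewrite (term _ (ehf a b c)) ?all_is_sl2_ehf ?ehf_consh.
- case: c abc term => // c abc term.
  by rewrite (term _ (ehf a b c)) ?all_is_sl2_ehf ?ehf_consf.
Qed.

(* Degenerate counters such as [b.-1] with [b = 0] only occur under a zero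
   coefficient, whence the guarded size hypothesis. *)
Lemma on_seqZ_guarded (m : nat) (B : ('I_m -> 'M[C]_2) -> 'M[C]_2)
    (n : nat) (k : C) x s t :
  in_Sg B -> in_sl2 x -> all is_sl2 s ->
  ((0 < n)%N -> (size s).+1 = m /\ perm_eq t (x :: s)) ->
  n%:R *: on_seq B (k *: x :: s) = (n%:R * k) *: on_seq B t.
Proof.
case: n => [|n] SB sl2_x sl2_s; first by rewrite mul0r !scale0r.
move=> [] // sz st; rewrite -scalerA on_seqZ //; congr (_ *: (_ *: _)).
rewrite (on_seq_perm SB (t := x :: s)) //.
by apply/andP; split=> //; apply/eqP.
Qed.

Lemma bracket_e_ehf (m : nat) (B : ('I_m -> 'M[C]_2) -> 'M[C]_2) a b c :
  in_Sg B -> (a + b + c)%N = m ->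
  bracket sl2_e (on_seq B (ehf a b c)) =
    (b%:R * - 2) *: on_seq B (ehf a.+1 b.-1 c)
    + c%:R *: on_seq B (ehf a b.+1 c.-1).
Proof.
move=> SB abc; rewrite (bracket_on_ehf SB) // bracket_ee bracket_eh bracket_ef.
(* Writing [[e,e]] as [0 *: e] and [[e,f]] as [1 *: h] lets [on_seqZ_guarded] treat all three
   terms. *)
rewrite -(scale0r sl2_e) -[X in X :: ehf a b c.-1]scale1r.
rewrite (on_seqZ_guarded _ SB (t := ehf a b c)) ?all_is_sl2_ehf //; last first.
  by case: a abc => // a <-; rewrite size_ehf.
rewrite (on_seqZ_guarded _ SB (t := ehf a.+1 b.-1 c)) ?all_is_sl2_ehf //; last first.
  by case: b abc => // b <-; rewrite size_ehf addnS.
rewrite (on_seqZ_guarded _ SB (t := ehf a b.+1 c.-1)) ?all_is_sl2_ehf //; last first.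
  by case: c abc => // c <-; rewrite size_ehf ehf_consh addnS.
by rewrite mulr0 scale0r add0r mulr1.
Qed.

Lemma bracket_f_ehf (m : nat) (B : ('I_m -> 'M[C]_2) -> 'M[C]_2) a b c :
  in_Sg B -> (a + b + c)%N = m ->
  bracket sl2_f (on_seq B (ehf a b c)) =
    (a%:R * - 1) *: on_seq B (ehf a.-1 b.+1 c)
    + (b%:R * 2) *: on_seq B (ehf a b.-1 c.+1).
Proof.
move=> SB abc; rewrite (bracket_on_ehf SB) // bracket_fe bracket_fh bracket_ff.
rewrite -(scale0r sl2_f).
rewrite (on_seqZ_guarded _ SB (t := ehf a.-1 b.+1 c)) ?all_is_sl2_ehf //; last first.
  by case: a abc => // a <-; rewrite size_ehf ehf_consh.
rewrite (on_seqZ_guarded _ SB (t := ehf a b.-1 c.+1)) ?all_is_sl2_ehf //; last first.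
  by case: b abc => // b <-; rewrite size_ehf ehf_consf addnS.
rewrite (on_seqZ_guarded _ SB (t := ehf a b c)) ?all_is_sl2_ehf //; last first.
  by case: c abc => // c <-; rewrite size_ehf ehf_consf addnS.
by rewrite mulr0 scale0r addr0.
Qed.

(** * Vanishing of [B] from its value at [(h, ..., h)] *)

(** Multilinear expansion by induction on the arbitrary prefix [s]: its head is written in the
    basis, and each basis vector is absorbed into the sorted tail. *)
Lemma on_seq_cat_ehf0 (m : nat) (B : ('I_m -> 'M[C]_2) -> 'M[C]_2) s a b c :
  in_Sg B -> all is_sl2 s -> (size s + (a + b + c))%N = m ->
  (forall a b c, (a + b + c)%N = m -> on_seq B (ehf a b c) = 0) ->
  on_seq B (s ++ ehf a b c) = 0.
Proof.
move=> SB + + B0; elim: s a b c => [|x s IHs] a b c; first by move=> _; apply: B0.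
move=> sl2_xs; have /andP[/eqP sl2_x sl2_s] : is_sl2 x && all is_sl2 s := sl2_xs.
move=> sz.
have sl2_sabc : all is_sl2 (s ++ ehf a b c) by rewrite all_cat sl2_s all_is_sl2_ehf.
have sz1 : (size (s ++ ehf a b c)).+1 = m by rewrite size_cat size_ehf -sz.
have step z a' b' c' : perm_eq (ehf a' b' c') (z :: ehf a b c) ->
    on_seq B (z :: (s ++ ehf a b c)) = 0.
  move=> zabc; have size_a' : (a' + b' + c')%N = (a + b + c).+1.
    by rewrite -!size_ehf; apply: perm_size zabc.
  rewrite (on_seq_perm SB (t := s ++ ehf a' b' c')).
  - by apply: IHs => //; rewrite size_a' -sz addnS.
  - by rewrite all_cat sl2_s all_is_sl2_ehf.
  - by rewrite size_cat size_ehf size_a' -sz addnS.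
  by rewrite -cat1s perm_catCA perm_cat2l perm_sym.
have sl2_hf : in_sl2 (x 0 0 *: sl2_h + x 1 0 *: sl2_f).
  by rewrite /in_sl2 mxtraceD !mxtraceZ sl2_h_in sl2_f_in !mulr0 addr0.
have sl2_xf : in_sl2 (x 1 0 *: sl2_f) by rewrite /in_sl2 mxtraceZ sl2_f_in mulr0.
rewrite cat_cons (sl2_decomp sl2_x) !on_seq_linear // on_seqZ //.
rewrite (step sl2_e a.+1 b c) // (step sl2_h a b.+1 c) ?ehf_consh //.
rewrite (step sl2_f a b c.+1) ?ehf_consf //.
by rewrite !scaler0 !addr0.
Qed.

Lemma in_Sg_eq0 (m : nat) (B : ('I_m -> 'M[C]_2) -> 'M[C]_2) :
  in_Sg B -> on_seq B (ehf 0 m 0) = 0 ->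
  forall xs, tuple_in_sl2 xs -> B xs = 0.
Proof.
move=> SB Bh xs sl2_xs.
have char0 n : n.+1%:R != 0 :> C by rewrite pnatr_eq0.
(* For [a = 0] the [f]-relation at [v 0 (b+1) c] has the single term [2 (b+1) v 0 b (c+1)]. *)
have Bf c b : (b + c)%N = m -> on_seq B (ehf 0 b c) = 0.
  elim: c b => [|c IHc] b bc; first by have -> : b = m by rewrite -bc addn0.
  have bc' : (0 + b.+1 + c)%N = m by rewrite add0n addSnnS.
  have := bracket_f_ehf SB bc'; rewrite IHc ?bracket0 -?bc' //.
  rewrite mul0r scale0r add0r => /esym/eqP; rewrite scaler_eq0 mulf_eq0.
  by rewrite (negbTE (char0 _)) (negbTE (char0 1)) => /eqP.
(* The [e]-relation at [v a (b+1) c] expresses [v (a+1) b c] through values with only [a] copies of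
   [e]. *)
have Bv a b c : (a + b + c)%N = m -> on_seq B (ehf a b c) = 0.
  elim: a b c => [|a IHa] b c abc; first exact: Bf.
  have abc' : (a + b.+1 + c)%N = m by rewrite -abc addnS.
  have := bracket_e_ehf SB abc'; rewrite IHa // bracket0.
  have -> : c%:R *: on_seq B (ehf a b.+2 c.-1) = 0.
    case: c abc abc' => [|c] abc _; first by rewrite scale0r.
    by rewrite IHa ?scaler0 // -abc !addnS !addSn.
  rewrite addr0 => /esym/eqP; rewrite scaler_eq0 mulf_eq0 oppr_eq0.
  by rewrite (negbTE (char0 _)) (negbTE (char0 1)) => /eqP.
pose s := [seq xs i | i <- enum 'I_m].
have sz : size s = m by rewrite size_map size_enum_ord.
have sl2_s : all is_sl2 s by apply/allP=> x /mapP[i _ ->]; apply/eqP/sl2_xs.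
have -> : B xs = on_seq B (s ++ ehf 0 0 0).
  congr (B _); apply: functional_extensionality => i.
  by rewrite cats0 (nth_map i) ?size_enum_ord // nth_ord_enum.
apply: (on_seq_cat_ehf0 SB sl2_s _ Bv). 
by rewrite sz !addn0.
Qed.

(** * Even degree *)

(* The middle conjunct says [B(e^(k-1), h^(2j+1), f^k) = 2 mu f], multiplied by
   [k] so that it is vacuous for [k = 0]. *)
Lemma on_seq_ehf_chain (n : nat) (B : ('I_(2 * n) -> 'M[C]_2) -> 'M[C]_2) (l : C) :
  in_Sg B -> on_seq B (ehf 0 (2 * n) 0) = l *: sl2_h ->
  forall k j, (j + k)%N = n -> exists mu : C,
    [/\ on_seq B (ehf k j.*2 k) = mu *: sl2_h,
        k%:R *: on_seq B (ehf k.-1 j.*2.+1 k) = (k%:R * (2 * mu)) *: sl2_f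
      & mu = 0 -> l = 0].
Proof.
move=> SB Bh; elim=> [|k IHk] j jk.
  exists l; split; rewrite ?mul0r ?scale0r // -Bh.
  by have -> : j.*2 = (2 * n)%N by rewrite -jk addn0 mul2n.
have [mu [vk wk mu0]] := IHk j.+1 (etrans (addSnnS j k) jk).
have Dv : (k + j.+1.*2 + k)%N = (2 * n)%N by rewrite -jk -mul2n; lia.
have Dw : (k + j.*2.+1 + k.+1)%N = (2 * n)%N by rewrite -jk -mul2n; lia.
have neq0 i : i.+1%:R != 0 :> C by rewrite pnatr_eq0.
(* The [f]-relation at [v k (2j+2) k] reads [2 (k+1) mu f = 2 (2j+2) v k (2j+1) (k+1)]; setting the
   last value equal to [2 mu' f] gives this constant. *)
pose mu' : C := k.+1%:R / (2 * j.+1.*2%:R) * mu.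
have mu'E : k.+1%:R * mu = 2 * j.+1.*2%:R * mu'.
  by rewrite /mu' [RHS]mulrA [X in _ = X * _]mulrC divfK ?mulf_neq0 ?neq0.
have mu'0 : mu' = 0 -> l = 0.
  by move/eqP; rewrite !mulf_eq0 invr_eq0 mulf_eq0 !(negbTE (neq0 _)) => /eqP.
have JE : j.+1.*2%:R = j.*2.+1%:R + 1 :> C by rewrite natr1.
move: mu' mu'E mu'0 => mu' mu'E mu'0.
have Ew : on_seq B (ehf k j.*2.+1 k.+1) = (2 * mu') *: sl2_f.
  have := bracket_f_ehf SB Dv; rewrite vk bracketZ bracket_fh.
  rewrite mulrN1 scaleNr wk => /eqP; rewrite eq_sym addrC subr_eq => /eqP Dw'.
  have b2 : j.+1.*2%:R * 2 != 0 :> C by rewrite mulf_neq0 ?neq0.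
  apply: (scalerI b2); rewrite Dw' !scalerA -scalerDl; congr (_ *: _).
  transitivity (2 * (k.+1%:R * mu)); last by rewrite mu'E; ring_C.
  by rewrite -natr1; ring_C.
exists mu'; split.
(* The same [mu'] serves here: the [e]-relation gives [-2 (2j+1) v (k+1) (2j) (k+1) = (2 - 2 (2j+2))
   mu' h]. *)
- have := bracket_e_ehf SB Dw; rewrite Ew bracketZ bracket_ef [k.+1.-1]/= [j.*2.+1.-1]/=.
  rewrite -[j.*2.+2]/(j.+1.*2) vk => /eqP; rewrite -subr_eq => /eqP Dv'.
  have b2 : j.*2.+1%:R * - 2 != 0 :> C by rewrite mulf_neq0 ?oppr_eq0 ?neq0.
  apply: (scalerI b2); rewrite -Dv' !scalerA -scalerBl; congr (_ *: _).
  by rewrite mu'E JE; ring_C.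
- by rewrite Ew scalerA.
- exact: mu'0.
Qed.

Lemma on_seq_h (m : nat) (B : ('I_m -> 'M[C]_2) -> 'M[C]_2) : in_Sg B ->
  on_seq B (ehf 0 m 0) = on_seq B (ehf 0 m 0) 0 0 *: sl2_h.
Proof.
move=> SB; have sz : size (ehf 0 m 0) = m by rewrite size_ehf addn0.
apply: centralizer_h.
  by have [sl2B _ _ _] := SB; apply/sl2B/tuple_in_sl2_nth; rewrite ?all_is_sl2_ehf.
rewrite (bracket_on_ehf SB) ?addn0 // bracket_hh !scale0r.
rewrite add0r addr0 -(scale0r sl2_h).
rewrite (on_seqZ_guarded _ SB (t := ehf 0 m 0)) ?all_is_sl2_ehf //.
  by rewrite mulr0 !scale0r.
by case: m B SB sz => // m _ _ _ _; rewrite size_ehf addn0 ehf_consh.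
Qed.

Lemma in_Sg_even (n : nat) (B : ('I_(2 * n) -> 'M[C]_2) -> 'M[C]_2) :
  in_Sg B -> forall xs, tuple_in_sl2 xs -> B xs = 0.
Proof.
move=> SB; apply: in_Sg_eq0 => //; have Bh := on_seq_h SB.
have [mu [vn wn mu0]] := on_seq_ehf_chain SB Bh (add0n n).
have Dv : (n + 0.*2 + n)%N = (2 * n)%N by rewrite addn0 addnn mul2n.
(* No [h] is left among the arguments, so only the [e]-term survives and the relation becomes
   [2 (n+1) mu f = 0]. *)
have := bracket_f_ehf SB Dv; rewrite vn bracketZ bracket_fh mul0r scale0r addr0.
rewrite mulrN1 scaleNr wn -scaleNr scalerA => /eqP.
rewrite -subr_eq0 -scalerBl scaler_eq0 => /orP[/eqP coef0 | /eqP f0]; last first.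
  have := f_equal (fun x : 'M[C]_2 => x 1 0) f0.
  by rewrite sl2E mxE => /eqP; rewrite oner_eq0.
rewrite Bh mu0 ?scale0r //; apply/eqP; move/eqP: coef0.
have -> : mu * 2 - - (n%:R * (2 * mu)) = n.+1%:R * 2 * mu.
  by rewrite -natr1; ring_C.
by rewrite !mulf_eq0 !pnatr_eq0.
Qed.

(** * Constructions of invariant maps *)

Lemma tuple_in_sl2_upd (m : nat) (xs : 'I_m -> 'M[C]_2) i y :
  tuple_in_sl2 xs -> in_sl2 y -> tuple_in_sl2 (upd xs i y).
Proof. by move=> sl2_xs sl2_y j; rewrite /upd; case: eqP. Qed.

Lemma in_sl2_lincomb (a : C) (x y : 'M[C]_2) :
  in_sl2 x -> in_sl2 y -> in_sl2 (a *: x + y).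
Proof. by rewrite /in_sl2 mxtraceD mxtraceZ => -> ->; rewrite mulr0 addr0. Qed.

Lemma in_sl2_sum (I : finType) (F : I -> 'M[C]_2) :
  (forall i, in_sl2 (F i)) -> in_sl2 (\sum_i F i).
Proof.
move=> sl2_F; apply: (big_ind in_sl2) => // [|x y sl2_x sl2_y].
  exact: mxtrace0.
by rewrite -[x]scale1r; apply: in_sl2_lincomb.
Qed.

(** Every condition evaluates the map only on traceless tuples, so its values elsewhere are
    irrelevant. *)
Lemma in_Sg_eq (m : nat) (B B' : ('I_m -> 'M[C]_2) -> 'M[C]_2) :
  (forall xs, tuple_in_sl2 xs -> B xs = B' xs) -> in_Sg B -> in_Sg B'.
Proof.
move=> BB' [sl2B linB symB invB]; split.
- by move=> xs sl2_xs; rewrite -BB' //; apply: sl2B.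
- move=> xs i a y z sl2_xs sl2_y sl2_z.
  rewrite -!BB' ?linB //; apply: tuple_in_sl2_upd => //; exact: in_sl2_lincomb.
- move=> xs s sl2_xs; rewrite -!BB' ?symB // => i; exact: sl2_xs.
move=> y xs sl2_y sl2_xs; rewrite -BB' // invB //; apply: eq_bigr => i _.
by apply/BB'/tuple_in_sl2_upd => //; apply: bracket_sl2.
Qed.

(** Besides settling the converse in even degree, the zero map is the second summand when
    [in_Sg_lincomb] is used for a scalar multiple. *)
Lemma in_Sg0 (m : nat) : in_Sg (fun _ : 'I_m -> 'M[C]_2 => 0).
Proof.
split=> //; first by move=> *; apply: mxtrace0.
- by move=> *; rewrite scaler0 addr0.
by move=> *; rewrite bracket0 big1.
Qed.

Lemma scaler_lincombAC (R : comNzRingType) (V : lmodType R) (a b : R) (u v u' v' : V) :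
  a *: (b *: u + v) + (b *: u' + v') = b *: (a *: u + u') + (a *: v + v').
Proof. by rewrite !scalerDr !scalerA [a * b]mulrC addrACA. Qed.

Lemma in_Sg_lincomb (m : nat) (a : C) (B B' : ('I_m -> 'M[C]_2) -> 'M[C]_2) :
  in_Sg B -> in_Sg B' -> in_Sg (fun xs => a *: B xs + B' xs).
Proof.
move=> [sl2B linB symB invB] [sl2B' linB' symB' invB']; split.
- by move=> xs sl2_xs; apply: in_sl2_lincomb; [apply: sl2B | apply: sl2B'].
- move=> xs i b y z sl2_xs sl2_y sl2_z.
  rewrite (linB xs i b y z sl2_xs sl2_y sl2_z) (linB' xs i b y z sl2_xs sl2_y sl2_z).
  exact: scaler_lincombAC.
- by move=> xs s sl2_xs; rewrite symB // symB'.
move=> y xs sl2_y sl2_xs.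
by rewrite bracket_linear invB // invB' // scaler_sumr -big_split.
Qed.

Lemma upd_perm (m : nat) (xs : 'I_m -> 'M[C]_2) (s : 'S_m) i y :
  upd xs (s i) y \o s = upd (xs \o s) i y.
Proof.
apply: functional_extensionality => j.
by rewrite /upd /= (inj_eq perm_inj).
Qed.

(** Reindexing the sum gives symmetry. Linearity and invariance hold summand by summand, because
    changing slot [i] before composing with [s] changes slot [s^-1 i] afterwards. *)
Lemma in_Sg_symmetrize (m : nat) (T : ('I_m -> 'M[C]_2) -> 'M[C]_2) :
  (forall xs, tuple_in_sl2 xs -> in_sl2 (T xs)) ->
  (forall xs i (a : C) y z,
     T (upd xs i (a *: y + z)) = a *: T (upd xs i y) + T (upd xs i z)) ->
  (forall y xs, bracket y (T xs) = \sum_(i < m) T (upd xs i (bracket y (xs i)))) ->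
  in_Sg (fun xs => \sum_(s : 'S_m) T (xs \o s)).
Proof.
move=> sl2T linT invT; split.
- by move=> xs sl2_xs; apply: in_sl2_sum => s; apply: sl2T => i; apply: sl2_xs.
- move=> xs i a y z _ _ _; rewrite scaler_sumr -big_split; apply: eq_bigr => s _.
  by rewrite -[i](permKV s) !upd_perm linT.
- move=> xs t _; rewrite [RHS](reindex_inj (mulIg t)); apply: eq_bigr => s _.
  by congr (T _); apply: functional_extensionality => i; rewrite /= permM.
move=> y xs _ _; rewrite bracket_sum exchange_big; apply: eq_bigr => s _.
rewrite invT [RHS](reindex_inj (@perm_inj _ s)); apply: eq_bigr => i _.
by rewrite upd_perm.
Qed.

(** * The unsymmetrized form of [B_n] *)

(* Slots are indexed by [nat], so that induction on [n] needs no casts between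
   ordinal types. *)
Definition pairing (n : nat) (ys : nat -> 'M[C]_2) : C :=
  \prod_(k < n) kform (ys (2 * k)%N) (ys (2 * k + 1)%N).

Definition updn (ys : nat -> 'M[C]_2) (p : nat) (z : 'M[C]_2) : nat -> 'M[C]_2 :=
  fun j => if j == p then z else ys j.

Lemma updnE ys p z j : updn ys p z j = if j == p then z else ys j.
Proof. by []. Qed.

Lemma pairingS (n : nat) ys :
  pairing n.+1 ys = pairing n ys * kform (ys (2 * n)%N) (ys (2 * n + 1)%N).
Proof. exact: big_ord_recr. Qed.

Lemma pairing_updn_out (n : nat) ys p z : (2 * n <= p)%N ->
  pairing n (updn ys p z) = pairing n ys.
Proof.
move=> np; apply: eq_bigr => k _; rewrite !updnE.
by rewrite !ifN //; have := ltn_ord k; lia.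
Qed.

Lemma pairing_linear (n : nat) ys p (a : C) y z : (p < 2 * n)%N ->
  pairing n (updn ys p (a *: y + z)) =
  a * pairing n (updn ys p y) + pairing n (updn ys p z).
Proof.
elim: n => [|n IHn] pn; first by rewrite muln0 in pn.
rewrite !pairingS; have [pn' | np] := ltnP p (2 * n)%N.
  have [n0 n1] : (2 * n)%N != p /\ (2 * n + 1)%N != p by lia.
  by rewrite IHn // !updnE !(negbTE n0) !(negbTE n1) mulrDl mulrA.
rewrite !pairing_updn_out // !updnE.
have n01 : (2 * n == 2 * n + 1)%N = false by lia.
have n10 : (2 * n + 1 == 2 * n)%N = false by lia.
have [-> | ->] : p = (2 * n)%N \/ p = (2 * n + 1)%N by lia.
  by rewrite eqxx n10 kform_linearl mulrDr mulrCA.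
by rewrite eqxx n01 kform_linearr mulrDr mulrCA.
Qed.

Lemma big_ord_double_recr (V : nmodType) (n : nat) (F : nat -> V) :
  \sum_(p < 2 * n.+1) F p = \sum_(p < 2 * n) F p + F (2 * n)%N + F (2 * n + 1)%N.
Proof.
by rewrite mulnS addnC addn2 big_ord_recr big_ord_recr addn1.
Qed.

(** By the Leibniz rule [w] acts on one factor at a time, and the two terms of each factor cancel by
    [kform_invariant]. *)
Lemma pairing_invariant (n : nat) ys w :
  \sum_(p < 2 * n) pairing n (updn ys p (bracket w (ys p))) = 0.
Proof.
elim: n => [|n IHn]; first by rewrite big1 // => -[].
rewrite (big_ord_double_recr n
  (fun p => pairing n.+1 (updn ys p (bracket w (ys p))))).
have -> : \sum_(p < 2 * n) pairing n.+1 (updn ys p (bracket w (ys p))) =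
    (\sum_(p < 2 * n) pairing n (updn ys p (bracket w (ys p))))
    * kform (ys (2 * n)%N) (ys (2 * n + 1)%N).
  rewrite mulr_suml; apply: eq_bigr => p _.
  have ltp := ltn_ord p.
  have n0 : (2 * n == p)%N = false by lia.
  have n1 : (2 * n + 1 == p)%N = false by lia.
  by rewrite pairingS [updn _ _ _ (2 * n)%N]updnE [updn _ _ _ (2 * n + 1)%N]updnE n0 n1.
have pairing_last p z : (2 * n <= p)%N -> pairing n.+1 (updn ys p z) =
    pairing n ys * kform (updn ys p z (2 * n)%N) (updn ys p z (2 * n + 1)%N).
  by move=> np; rewrite pairingS pairing_updn_out.
rewrite IHn mul0r add0r.
apply: (etrans (f_equal2 +%R (pairing_last _ _ (leqnn _))
                             (pairing_last _ _ (leq_addr 1 _)))).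
rewrite -mulrDr !updnE.
have n01 : (2 * n == 2 * n + 1)%N = false by lia.
have n10 : (2 * n + 1 == 2 * n)%N = false by lia.
by rewrite !eqxx n01 n10 kform_invariant mulr0.
Qed.

Definition paired (n : nat) (ys : nat -> 'M[C]_2) : 'M[C]_2 :=
  pairing n ys *: ys (2 * n)%N.

Lemma paired_linear (n : nat) ys p (a : C) y z : (p < (2 * n).+1)%N ->
  paired n (updn ys p (a *: y + z)) =
  a *: paired n (updn ys p y) + paired n (updn ys p z).
Proof.
rewrite ltnS leq_eqVlt /paired => /orP[/eqP-> | ltp].
  rewrite 3?pairing_updn_out ?leqnn // !updnE eqxx scalerDr !scalerA.
  by rewrite mulrC.
have np : (2 * n == p)%N = false by lia.
by rewrite pairing_linear // !updnE np scalerDl scalerA.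
Qed.

Lemma paired_invariant (n : nat) ys w :
  bracket w (paired n ys) =
  \sum_(p < (2 * n).+1) paired n (updn ys p (bracket w (ys p))).
Proof.
rewrite big_ord_recr /paired.
(* The 0 is introduced to be replaced by the vanishing sum of [pairing_invariant], which accounts
   for the first [2n] slots. *)
transitivity (0 *: ys (2 * n)%N + bracket w (paired n ys)).
  by rewrite scale0r add0r.
rewrite -(pairing_invariant n ys w) scaler_suml; congr (_ + _).
  apply: eq_bigr => p _; congr (_ *: _); have ltp := ltn_ord p.
  have np : (2 * n == p)%N = false by lia.
  by rewrite updnE np.
by rewrite pairing_updn_out // updnE eqxx bracketZ.
Qed.

(** The bound matters: [inord] sends every [p] above [m] to slot 0. This is why [paired_ext]
    compares only the slots up to [2n]. *)
Lemma updn_inord (m : nat) (xs : 'I_m.+1 -> 'M[C]_2) (i : 'I_m.+1) z p :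
  (p <= m)%N -> upd xs i z (inord p) = updn (fun j => xs (inord j)) i z p.
Proof. by move=> pm; rewrite /upd /updn -val_eqE /= inordK. Qed.

Lemma paired_ext (n : nat) ys zs :
  (forall p, (p <= 2 * n)%N -> ys p = zs p) -> paired n ys = paired n zs.
Proof.
move=> yz; apply: (f_equal2 *:%R _ (yz _ (leqnn _))); apply: eq_bigr => k _.
have [lt0 lt1] : (2 * k <= 2 * n)%N /\ (2 * k + 1 <= 2 * n)%N.
  by have := ltn_ord k; lia.
exact: (f_equal2 kform (yz _ lt0) (yz _ lt1)).
Qed.

Definition paired_ord (n : nat) (xs : 'I_(2 * n).+1 -> 'M[C]_2) : 'M[C]_2 :=
  paired n (fun j => xs (inord j)).

Lemma in_Sg_paired (n : nat) :
  in_Sg (fun xs => \sum_(s : 'S_(2 * n).+1) @paired_ord n (xs \o s)).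
Proof.
have upd_paired xs (i : 'I_(2 * n).+1) z :
    paired_ord (upd xs i z) = paired n (updn (fun j => xs (inord j)) i z).
  by apply: paired_ext => p pn; apply: updn_inord.
apply: in_Sg_symmetrize.
- move=> xs sl2_xs; rewrite /in_sl2 mxtraceZ; have -> := sl2_xs (inord (2 * n)).
  by rewrite mulr0.
- by move=> xs i a y z; rewrite !upd_paired; apply: paired_linear.
move=> y xs; rewrite [LHS]paired_invariant; apply: eq_bigr => i _.
by rewrite upd_paired inord_val.
Qed.

(** * [B_n] as a symmetrization *)

(** The image of [ord_max] recovers [k] and the other images recover [s]; surjectivity follows from
    [(m+1) m! = (m+1)!]. *)
Lemma lift_perm_bij (m : nat) :
  bijective (fun ks : 'I_m.+1 * 'S_m => lift_perm ord_max ks.1 ks.2).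
Proof.
apply: inj_card_bij => [[k s] [l t] /= kslt|].
  have kl : k = l by rewrite -(lift_perm_id ord_max k s) kslt lift_perm_id.
  subst l; congr (_, _); apply/permP => i; apply: (@lift_inj _ k).
  by rewrite -!(lift_perm_lift ord_max) kslt.
by rewrite card_prod card_ord !card_Sn factS.
Qed.

(* A permutation of [2n+1] slots is the choice of the last slot's entry and a
   permutation of the remaining ones. *)
Lemma BnE (n : nat) (xs : 'I_(2 * n).+1 -> 'M[C]_2) :
  Bn xs = ((2 * n)`!%:R)^-1 *: \sum_(s : 'S_(2 * n).+1) paired_ord (xs \o s).
Proof.
rewrite (reindex _ (onW_bij _ (lift_perm_bij (2 * n)))).
rewrite -(pair_bigA _ (fun k s => paired_ord (xs \o lift_perm ord_max k s))).
rewrite scaler_sumr; apply: eq_bigr => k _.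
rewrite /Pn -scalerA scaler_suml; congr (_ *: _); apply: eq_bigr => s _.
have inord_lift (i : 'I_(2 * n)) : inord i = lift ord_max i :> 'I_(2 * n).+1.
  by apply: ord_inj; rewrite inordK ?lift_max // ltnS ltnW.
have kE : lift_perm ord_max k s (inord (2 * n)) = k.
  rewrite (_ : inord (2 * n) = ord_max) ?lift_perm_id //.
  by apply: ord_inj; rewrite inordK.
apply: (f_equal2 *:%R _ (f_equal xs (esym kE))).
apply: eq_bigr => j _; rewrite -!(lift_perm_lift ord_max).
by rewrite -(inord_lift (ev_idx j)) -(inord_lift (od_idx j)).
Qed.

Lemma in_Sg_Bn (n : nat) : in_Sg (@Bn n).
Proof.
apply: (in_Sg_eq _ (in_Sg_lincomb ((2 * n)`!%:R)^-1 (in_Sg_paired n) (in_Sg0 _))).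
by move=> xs _; rewrite addr0 -BnE.
Qed.

(** * Odd degree: comparison with [B_n] at [(h, ..., h)] *)

(** All [(2n)!] products in [P_n] equal [4 ^ n] since [<h,h> = 4], so the normalization cancels, and
    each of the [2n+1] omitted slots contributes equally. *)
Lemma Bn_h (n : nat) : Bn (fun _ : 'I_(2 * n).+1 => sl2_h) =
  ((2 * n).+1%:R * 4 ^+ n) *: sl2_h.
Proof.
have hh : kform sl2_h sl2_h = 4.
  by rewrite kformE !sl2E; ring_C.
have fact0 : (2 * n)`!%:R != 0 :> C by rewrite pnatr_eq0 -lt0n fact_gt0.
rewrite /Bn sumr_const card_ord /Pn.
under eq_bigr => s _ do rewrite prodr_const card_ord hh.
rewrite sumr_const card_Sn -[_ ^+ n *+ _]mulr_natl mulKf //.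
by rewrite -scaler_nat scalerA.
Qed.

Lemma in_Sg_odd (n : nat) (B : ('I_(2 * n).+1 -> 'M[C]_2) -> 'M[C]_2) :
  in_Sg B -> exists c : C, forall xs, tuple_in_sl2 xs -> B xs = c *: Bn xs.
Proof.
move=> SB; set m := (2 * n).+1.
have hE (B' : ('I_m -> 'M[C]_2) -> 'M[C]_2) :
    on_seq B' (ehf 0 m 0) = B' (fun=> sl2_h).
  congr (B' _); apply: functional_extensionality => i.
  by rewrite /ehf cats0 nth_nseq ltn_ord.
have b0 : (2 * n).+1%:R * 4 ^+ n != 0 :> C.
  by rewrite mulf_neq0 ?expf_neq0 ?pnatr_eq0.
set b := (X in X != 0) in b0.
have [l Bh] : exists l : C, B (fun=> sl2_h) = l *: sl2_h.
  by exists (on_seq B (ehf 0 m 0) 0 0); rewrite -hE; apply: on_seq_h.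
(* This ratio makes [B - (l / b) B_n] vanish at [(h, ..., h)], hence everywhere by [in_Sg_eq0]. *)
exists (l / b) => xs sl2_xs; apply/eqP; rewrite -subr_eq0 addrC -scaleNr; apply/eqP.
apply: (in_Sg_eq0 (in_Sg_lincomb (- (l / b)) (in_Sg_Bn n) SB)) => //.
by rewrite hE Bn_h Bh scaleNr scalerA divfK // addNr.
Qed.

Unset Implicit Arguments.

Theorem theorem5 (n : nat) : (1 <= n)%N ->
  (forall B : ('I_(2 * n) -> 'M[C]_2) -> 'M[C]_2,
     in_Sg B <-> (forall xs, tuple_in_sl2 xs -> B xs = 0)) /\
  (forall B : ('I_(2 * n).+1 -> 'M[C]_2) -> 'M[C]_2,
     in_Sg B <-> exists c : C, forall xs, tuple_in_sl2 xs -> B xs = c *: Bn xs).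
Proof.
move=> _; split=> B; split.
- exact: in_Sg_even.
- by move=> B0; apply: (in_Sg_eq _ (in_Sg0 _)) => xs sl2_xs; rewrite B0.
- exact: in_Sg_odd.
move=> [c Bc]; apply: (in_Sg_eq _ (in_Sg_lincomb c (in_Sg_Bn n) (in_Sg0 _))).
by move=> xs sl2_xs; rewrite addr0 Bc.
Qed.
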